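(* Let $R$ be a commutative ring with identity. Let $\mathcal{D}$ be the category of digital images and digitally continuous functions and let $\mathcal{M}$ be the category of $R$-modules and $R$-module homomorphisms. For each $n\ge 0$, the $n$th digital homology $dH_n=dH_n(-;R):\mathcal{D}\to\mathcal{M}$ is a covariant functor, and the $n$th digital cohomology $dH^n=dH^n(-;R):\mathcal{D}\to\mathcal{M}$ is a contravariant functor.
   Context: A digital image is a pair $(X,k_X)$ where $X$ is a finite subset of some $\mathbb{Z}^n$ and $k_X$ is an adjacency relation (symmetric, irreflexive) on $X$. The basic examples are the $k(u,n)$-adjacencies, $1\le u\le n$: distinct $p,q\in\mathbb{Z}^n$ are $k(u,n)$-adjacent if $|p_i-q_i|=1$ for at most $u$ indices $i$ and $p_j=q_j$ for all other indices $j$. A subset $A\subseteq X$ is $k_X$-connected if any two distinct points of $A$ are joined by a finite sequence of distinct points of $A$ in which consecutive points are $k_X$-adjacent. A function $f:X\to Y$ is $(k_X,k_Y)$-continuous (digitally continuous) if it sends every $k_X$-connected subset of $X$ to a $k_Y$-connected subset of $Y$. The digital standard $n$-simplex is $\Delta^n=\{e_0,\dots,e_n\}\subset\mathbb{Z}^{n+1}$ (standard basis vectors, linearly ordered by index) with $k(2,n+1)$-adjacency, so any two distinct points of $\Delta^n$ are adjacent. A digital $n$-simplex in $(X,k_X)$ is a continuous function $\sigma:\Delta^n\to X$. $dC_n(X;R)$ is the free $R$-module on all digital $n$-simplexes in $X$. With $\epsilon_i^n:\Delta^{n-1}\to\Delta^n$ the order-preserving injection omitting $e_i$, the boundary operator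 is $\partial_n\sigma=\sum_{i=0}^n(-1)^i\sigma\circ\epsilon_i^n$ for $n\ge1$, and $\partial_0=0$; one has $\partial_n\partial_{n+1}=0$. Define $dH_n(X;R)=\ker\partial_n/\operatorname{im}\partial_{n+1}$, and let $dH^n(X;R)$ be the $n$th cohomology of the dual cochain complex $\operatorname{Hom}_R(dC_*(X;R),R)$. A continuous $f:X\to Y$ induces the chain map $f_\sharp(\sum r_\sigma\sigma)=\sum r_\sigma (f\circ\sigma)$; $dH_n(f)=f_*$ sends $[z]$ to $[f_\sharp(z)]$, and $dH^n(f)=f^*$ is induced by the dual of $f_\sharp$. *)

(* Defs.v *)
From HB Require Import structures.
From mathcomp Require Import all_boot all_order all_algebra finmap boolp zify.

Set Implicit Arguments.
Unset Strict Implicit.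
Unset Printing Implicit Defensive.

Import GRing.Theory Num.Theory.
Local Open Scope ring_scope.
Local Open Scope quotient_scope.

Record category := Category {
  ob :> Type;
  hom : ob -> ob -> Type;
  idc : forall A, hom A A;
  compc : forall A B C, hom B C -> hom A B -> hom A C;
  compcA : forall A B C D (h : hom C D) (g : hom B C) (f : hom A B),
    compc h (compc g f) = compc (compc h g) f;
  comp1c : forall A B (f : hom A B), compc (idc B) f = f;
  compc1 : forall A B (f : hom A B), compc f (idc A) = f
}.

Arguments idc {c} A.
Arguments compc {c A B C} _ _.

Definition opposite (C : category) : category :=
  @Category C (fun A B => hom B A) (fun A => idc A)
    (fun A B D g f => compc f g)
    (fun A B D E h g f => esym (compcA f g h))
    (fun A B f => compc1 f) (fun A B f => comp1c f).

(* The object map is a parameter, so that one can state that a given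
   construction on objects carries a functor without transporting along
   equalities of objects. *)
Record functor_on (C D : category) (F : C -> D) := FunctorOn {
  fmap :> forall A B : C, hom A B -> hom (F A) (F B);
  fmap_id : forall A : C, fmap (idc A) = idc (F A);
  fmap_comp : forall (A B E : C) (g : hom B E) (f : hom A B),
    fmap (compc g f) = compc (fmap g) (fmap f)
}.

Arguments fmap {C D F} _ {A B} _.

Definition cofunctor_on (C D : category) (F : C -> D) :=
  @functor_on (opposite C) D F.

Lemma linear_ext (R : pzRingType) (U V : lmodType R) (f g : {linear U -> V}) :
  f =1 g -> f = g.
Proof.
case: f => f [[f1] [f2]]; case: g => g [[g1] [g2]] /= /funext fg.
case: g / fg g1 g2 => g1 g2.
by rewrite (Prop_irrelevance f1 g1) (Prop_irrelevance f2 g2).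
Qed.

Section ModuleCategory.
Variable R : pzRingType.

Definition lin_id (U : lmodType R) : {linear U -> U} := idfun.
Definition lin_comp (U V W : lmodType R)
  (g : {linear V -> W}) (f : {linear U -> V}) : {linear U -> W} := g \o f.

Lemma lin_compA (U V W T : lmodType R) (h : {linear W -> T})
    (g : {linear V -> W}) (f : {linear U -> V}) :
  lin_comp h (lin_comp g f) = lin_comp (lin_comp h g) f.
Proof. exact: linear_ext. Qed.

Lemma lin_comp1f (U V : lmodType R) (f : {linear U -> V}) :
  lin_comp (lin_id V) f = f.
Proof. exact: linear_ext. Qed.

Lemma lin_compf1 (U V : lmodType R) (f : {linear U -> V}) :
  lin_comp f (lin_id U) = f.
Proof. exact: linear_ext. Qed.

Definition modCat : category :=
  @Category (lmodType R) (fun U V => {linear U -> V}) lin_id lin_comp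
    lin_compA lin_comp1f lin_compf1.

End ModuleCategory.

Section Homology.
Variables (R : pzRingType) (U V W : lmodType R).
Variables (f : {linear U -> V}) (g : {linear V -> W}).

Definition kernel : {pred V} := fun v => g v == 0.

Lemma kernel_closed : GRing.submod_closed kernel.
Proof.
split=> [|a u v]; rewrite !unfold_in ?linear0 // linearP => /eqP -> /eqP ->.
by rewrite scaler0 addr0.
Qed.

HB.instance Definition _ :=
  GRing.isSubmodClosed.Build R V kernel (GRing.submod_closed_semi kernel_closed).

Record cycles := Cycle { cycle_val : V; _ : cycle_val \in kernel }.

HB.instance Definition _ := [isSub for cycle_val].
HB.instance Definition _ := [Choice of cycles by <:].
HB.instance Definition _ := [SubChoice_isSubLmodule of cycles by <:].

(* The image of f as a submodule of ker g. It is all of im f when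
   g \o f = 0, as for the (co)chain complexes below. *)
Definition bounds : {pred cycles} := fun z => `[< exists u, f u = val z >].

Lemma bounds_closed : GRing.submod_closed bounds.
Proof.
split=> [|a z1 z2]; rewrite !unfold_in.
  by apply/asboolP; exists 0; rewrite linear0.
move=> /asboolP[u1 e1] /asboolP[u2 e2]; apply/asboolP; exists (a *: u1 + u2).
by rewrite linearP e1 e2.
Qed.

HB.instance Definition _ := GRing.isSubmodClosed.Build R cycles bounds
  (GRing.submod_closed_semi bounds_closed).

Definition homology := Quotient.quot bounds.

HB.instance Definition _ := GRing.Zmodule.on homology.
HB.instance Definition _ := EqQuotient.on homology.

Definition hclass (z : cycles) : homology := \pi z.

Lemma hclassP z1 z2 : reflect (hclass z1 = hclass z2) (z1 - z2 \in bounds).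
Proof. by rewrite Quotient.idealrBE; apply: eqP. Qed.

Lemma hclass_repr h : hclass (repr h) = h.
Proof. exact: reprK. Qed.

Lemma hclassD : {morph hclass : x y / x + y}.
Proof. by move=> x y; rewrite /hclass !piE. Qed.

(* The module structure is the one making hclass linear, see hclassD and
   hclassZ. *)
Definition hscale (a : R) (h : homology) : homology := hclass (a *: repr h).

Lemma hscaleE a z : hscale a (hclass z) = hclass (a *: z).
Proof.
apply/hclassP; rewrite -scalerBr rpredZ //; apply/hclassP.
exact: hclass_repr.
Qed.

Lemma hscaleA a b h : hscale a (hscale b h) = hscale (a * b) h.
Proof. by rewrite -(hclass_repr h) !hscaleE scalerA. Qed.

Lemma hscale1 : left_id 1 hscale.
Proof. by move=> h; rewrite -(hclass_repr h) !hscaleE scale1r. Qed.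

Lemma hscaleDr : right_distributive hscale +%R.
Proof.
move=> a h k; rewrite -(hclass_repr h) -(hclass_repr k).
by rewrite -hclassD !hscaleE -hclassD scalerDr.
Qed.

Lemma hscaleDl h : {morph hscale^~ h : a b / a + b}.
Proof.
by move=> a b; rewrite -(hclass_repr h) !hscaleE -hclassD scalerDl.
Qed.

HB.instance Definition _ := GRing.Zmodule_isLmodule.Build R homology
  hscaleA hscale1 hscaleDr hscaleDl.

Lemma hclassZ a z : hclass (a *: z) = a *: hclass z.
Proof. by rewrite -hscaleE. Qed.

End Homology.

(* For every cycle z, phi z is a cycle and h [z] = [phi z]; this determines h
   from phi. *)
Definition induces (R : pzRingType) (U V W U' V' W' : lmodType R)
    (f : {linear U -> V}) (g : {linear V -> W})
    (f' : {linear U' -> V'}) (g' : {linear V' -> W'})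
    (phi : V -> V') (h : homology f g -> homology f' g') : Prop :=
  forall z : cycles g, exists2 z' : cycles g',
    phi (val z) = val z' & h (hclass f z) = hclass f' z'.

Arguments induces {R U V W U' V' W'} f g f' g' phi h.

Section Dual.
Variable R : comPzRingType.

Definition dualmod (U : lmodType R) : Type := {linear U -> R^o}.

Section DualModule.
Variable U : lmodType R.

HB.instance Definition _ := gen_eqMixin (dualmod U).
HB.instance Definition _ := gen_choiceMixin (dualmod U).

Definition dual0 : dualmod U := \0.
Definition dualN (p : dualmod U) : dualmod U :=
  \- (p : {linear U -> R^o}).
Definition dualD (p q : dualmod U) : dualmod U :=
  (p : {linear U -> R^o}) \+ (q : {linear U -> R^o}).
Definition dualZ (a : R) (p : dualmod U) : dualmod U :=
  a \*: (p : {linear U -> R^o}).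

Fact dualDA : associative dualD.
Proof. by move=> p q r; apply: linear_ext => u /=; rewrite addrA. Qed.
Fact dualDC : commutative dualD.
Proof. by move=> p q; apply: linear_ext => u /=; rewrite addrC. Qed.
Fact dual0D : left_id dual0 dualD.
Proof. by move=> p; apply: linear_ext => u /=; rewrite add0r. Qed.
Fact dualND : left_inverse dual0 dualN dualD.
Proof. by move=> p; apply: linear_ext => u /=; rewrite addNr. Qed.

HB.instance Definition _ :=
  GRing.isZmodule.Build (dualmod U) dualDA dualDC dual0D dualND.

Fact dualZA a b p : dualZ a (dualZ b p) = dualZ (a * b) p.
Proof. by apply: linear_ext => u /=; rewrite scalerA. Qed.
Fact dual1Z : left_id 1 dualZ.
Proof. by move=> p; apply: linear_ext => u /=; rewrite scale1r. Qed.
Fact dualZDr : right_distributive dualZ +%R.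
Proof. by move=> a p q; apply: linear_ext => u /=; rewrite scalerDr. Qed.
Fact dualZDl p : {morph dualZ^~ p : a b / a + b}.
Proof. by move=> a b; apply: linear_ext => u /=; rewrite scalerDl. Qed.

HB.instance Definition _ := GRing.Zmodule_isLmodule.Build R (dualmod U)
  dualZA dual1Z dualZDr dualZDl.

End DualModule.

Definition dualmap (U V : lmodType R) (f : {linear U -> V})
  (p : dualmod V) : dualmod U := (p : {linear V -> R^o}) \o f.

Fact dualmap_linear (U V : lmodType R) (f : {linear U -> V}) :
  linear (dualmap f).
Proof. by move=> a p q; apply: linear_ext. Qed.

HB.instance Definition _ (U V : lmodType R) (f : {linear U -> V}) :=
  GRing.isLinear.Build R (dualmod V) (dualmod U) *:%R (dualmap f)
    (dualmap_linear f).

End Dual.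

Section FreeModule.
Variables (R : pzRingType) (S : finType).

Definition freemod := {ffun S -> R^o}.
HB.instance Definition _ := GRing.Lmodule.on freemod.

Definition fgen (s : S) : freemod := [ffun t => (t == s)%:R].

Definition linext (V : lmodType R) (phi : S -> V) (c : freemod) : V :=
  \sum_s (c s : R) *: phi s.

Fact linext_linear (V : lmodType R) (phi : S -> V) : linear (linext phi).
Proof.
move=> a c d; rewrite /linext scaler_sumr -big_split; apply: eq_bigr => s _ /=.
by rewrite !ffunE scalerDl scalerA.
Qed.

HB.instance Definition _ (V : lmodType R) (phi : S -> V) :=
  GRing.isLinear.Build R freemod V *:%R (@linext V phi) (linext_linear phi).

Lemma linext_gen (V : lmodType R) (phi : S -> V) s : linext phi (fgen s) = phi s.
Proof.
rewrite /linext (bigD1 s) //= ffunE eqxx scale1r big1 ?addr0 // => t ts.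
by rewrite ffunE (negPf ts) scale0r.
Qed.

End FreeModule.

Arguments fgen {R S} s.

Record digimage := DigImage {
  dim : nat;
  pts :> {fset 'rV[int]_dim};
  adj : rel pts;
  adj_sym : symmetric adj;
  adj_irr : irreflexive adj
}.

Definition kadj (u n : nat) : rel 'rV[int]_n := fun p q =>
  [&& p != q, (#|[set i | `|p 0%R i - q 0%R i|%R == 1]| <= u)%N &
      [forall i, (`|p 0%R i - q 0%R i|%R == 1) || (p 0%R i == q 0%R i)]].

Lemma kadj_sym u n : symmetric (@kadj u n).
Proof.
move=> p q; rewrite /kadj eq_sym; congr [&& _, (_ <= _)%N & _].
  by apply: eq_card => i; rewrite !inE distrC.
by apply: eq_forallb => i; rewrite distrC [q _ _ == _]eq_sym.
Qed.

Lemma kadj_irr u n : irreflexive (@kadj u n).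
Proof. by move=> p; rewrite /kadj eqxx. Qed.

Definition kimage (u n : nat) (A : {fset 'rV[int]_n}) : digimage :=
  @DigImage n A (fun p q => kadj u (val p) (val q))
    (fun p q => kadj_sym u (val p) (val q)) (fun p => kadj_irr u (val p)).

Section Continuity.
Implicit Types X Y Z T : digimage.

Definition dconnected (X : digimage) (A : {set X}) : Prop :=
  forall p q, p \in A -> q \in A -> p != q ->
    exists s : seq X, [/\ path (@adj X) p s, last p s = q,
      uniq (p :: s) & {subset p :: s <= A}].

Definition dcontinuous (X Y : digimage) (f : X -> Y) : Prop :=
  forall A : {set X}, dconnected A -> dconnected (f @: A).

Record dmap (X Y : digimage) := DMap {
  dmap_fun :> {ffun X -> Y};
  _ : `[< dcontinuous dmap_fun >]
}.

HB.instance Definition _ X Y := [isSub for @dmap_fun X Y].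
HB.instance Definition _ X Y := [Finite of dmap X Y by <:].

Lemma dmapP X Y (f : dmap X Y) : dcontinuous f.
Proof. exact/asboolP/(valP f). Qed.

Arguments dmapP {X Y} f.

Lemma dmap_ext X Y (f g : dmap X Y) : f =1 g -> f = g.
Proof. by move=> fg; apply/val_inj/ffunP. Qed.

Definition mkdmap X Y (f : X -> Y) (fc : dcontinuous f) : dmap X Y.
Proof.
exists (finfun f); apply/asboolP => A /fc.
by congr dconnected; apply: eq_imset => x; rewrite ffunE.
Defined.

Lemma mkdmapE X Y (f : X -> Y) (fc : dcontinuous f) x : mkdmap fc x = f x.
Proof. by rewrite ffunE. Qed.

Lemma did_continuous (X : digimage) : dcontinuous (@id X).
Proof. by move=> A; rewrite imset_id. Qed.

Lemma dcomp_continuous X Y Z (g : dmap Y Z) (f : dmap X Y) :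
  dcontinuous (g \o f).
Proof. by move=> A /(dmapP f)/(dmapP g); rewrite imset_comp. Qed.

Arguments dcomp_continuous {X Y Z} g f.

Definition did X : dmap X X := mkdmap (@did_continuous X).
Definition dcomp X Y Z (g : dmap Y Z) (f : dmap X Y) : dmap X Z :=
  mkdmap (dcomp_continuous g f).

Lemma didE X x : did X x = x.
Proof. exact: mkdmapE. Qed.

Lemma dcompE X Y Z (g : dmap Y Z) (f : dmap X Y) x : dcomp g f x = g (f x).
Proof. exact: mkdmapE. Qed.

Lemma dcompA X Y Z T (h : dmap Z T) (g : dmap Y Z) (f : dmap X Y) :
  dcomp h (dcomp g f) = dcomp (dcomp h g) f.
Proof. by apply: dmap_ext => x; rewrite !dcompE. Qed.

Lemma dcomp1f X Y (f : dmap X Y) : dcomp (did Y) f = f.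
Proof. by apply: dmap_ext => x; rewrite dcompE didE. Qed.

Lemma dcompf1 X Y (f : dmap X Y) : dcomp f (did X) = f.
Proof. by apply: dmap_ext => x; rewrite dcompE didE. Qed.

End Continuity.

Definition digCat : category :=
  @Category digimage dmap did dcomp dcompA dcomp1f dcompf1.

Section Simplex.
Implicit Types X : digimage.

Definition evec n (i : 'I_n.+1) : 'rV[int]_n.+1 := delta_mx 0 i.

Definition Delta n : digimage :=
  kimage 2 [fset evec i | i in 'I_n.+1]%fset.

Lemma evec_in n i : @evec n i \in pts (Delta n).
Proof. exact: in_imfset. Qed.

Definition vert n (i : 'I_n.+1) : Delta n := [` evec_in i ]%fset.

Lemma vert_ex n (v : Delta n) : exists i, vert i == v.
Proof.
case: v => v vin; have /imfsetP[i _ vE] := vin.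
by exists i; apply/eqP/val_inj.
Qed.

Definition vindex n (v : Delta n) : 'I_n.+1 := xchoose (vert_ex v).

Lemma vindexK n : cancel (@vindex n) (@vert n).
Proof. by move=> v; apply/eqP/(xchooseP (vert_ex v)). Qed.

Lemma evec_inj n : injective (@evec n).
Proof.
move=> i j /matrixP/(_ 0 i); rewrite !mxE !eqxx /=.
by case: (i =P j).
Qed.

Lemma vertK n : cancel (@vert n) (@vindex n).
Proof. by move=> i; have := vindexK (vert i) => /(congr1 val)/evec_inj. Qed.

Lemma Delta_adj n (v w : Delta n) : adj v w = (v != w).
Proof.
apply/idP/idP => [|vw]; first by case/and3P.
have ij : vindex v != vindex w by rewrite (can_eq (@vindexK n)).
rewrite -[v]vindexK -[w]vindexK /= /kadj; move: (vindex v) (vindex w) ij.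
move=> i j ij /=.
have E k : evec i 0%R k - evec j 0%R k = (k == i)%:R - (k == j)%:R.
  by rewrite !mxE.
apply/and3P; split; first by rewrite (inj_eq (@evec_inj n)).
  apply: leq_trans (_ : #|[set i; j]| <= 2)%N; last by rewrite cards2; case: eqP.
  apply: subset_leq_card; apply/subsetP => k; rewrite !inE E.
  by case: (k == i); case: (k == j).
apply/forallP => k; rewrite -[evec i _ _ == _]subr_eq0 E.
by case: (k == i); case: (k == j).
Qed.

Lemma to_Delta_continuous X n (f : X -> Delta n) : dcontinuous f.
Proof.
move=> A _ p q pA qA pq; exists [:: q]; split=> //.
- by apply/andP; split; first rewrite Delta_adj.
- by rewrite /= inE pq.
by move=> r; rewrite !inE => /orP[] /eqP ->.
Qed.

(* lift i is the increasing injection of {0..n} into {0..n+1} omitting i. *)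
Definition face n (i : 'I_n.+2) : dmap (Delta n) (Delta n.+1) :=
  mkdmap (@to_Delta_continuous (Delta n) n.+1
            (fun v => vert (lift i (vindex v)))).

End Simplex.

Lemma face_face n (i : 'I_n.+3) (j : 'I_n.+2) :
  dcomp (face i) (face j) =
  dcomp (face (lift i j)) (face (inord (unbump j i))).
Proof.
apply: dmap_ext => v; rewrite !dcompE !mkdmapE !vertK; congr vert.
apply: val_inj; rewrite /= inordK; first exact: bumpC.
rewrite /unbump; by have := ltn_ord i; have := ltn_ord j; case: ltnP => /=; lia.
Qed.

Definition simplex (n : nat) (X : digimage) : finType := dmap (Delta n) X.

Section Chains.
Variable R : comPzRingType.

(* X is finite, so there are finitely many digital n-simplexes in it. *)
Definition chain (n : nat) (X : digimage) : lmodType R :=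
  freemod R (simplex n X).

(* The zero map out of dC_0 is given the target chain 0.-1 = chain 0: it has
   the right kernel, and its dual has the right (zero) image. *)
Definition boundary (n : nat) (X : digimage) :
    {linear chain n X -> chain n.-1 X} :=
  match n return {linear chain n X -> chain n.-1 X} with
  | 0 => \0
  | m.+1 => linext (fun s : simplex m.+1 X =>
      \sum_(i < m.+2) (-1) ^+ i *: (fgen (dcomp s (face i)) : chain m X))
  end.

Definition pushforward (n : nat) (X Y : digimage) (f : dmap X Y) :
    {linear chain n X -> chain n Y} :=
  linext (fun s : simplex n X => fgen (dcomp f s) : chain n Y).

Lemma alternating_sum0 n (V : lmodType R) (G : 'I_n.+3 -> 'I_n.+2 -> V) :
    (forall i j, G (lift i j) (inord (unbump j i)) = G i j) ->
  \sum_(i < n.+3) \sum_(j < n.+2) (-1) ^+ (i + j)%N *: G i j = 0.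
Proof.
move=> HG; rewrite pair_big /=.
pose tau (p : 'I_n.+3 * 'I_n.+2) : 'I_n.+3 * 'I_n.+2 :=
  (lift p.1 p.2, inord (unbump p.2 p.1)).
have tau2 p : val (tau p).2 = unbump p.2 p.1.
  rewrite /= inordK // /unbump.
  by have := ltn_ord p.1; have := ltn_ord p.2; case: ltnP => /=; lia.
have tauK : involutive tau.
  move=> p; have lt1 := ltn_ord p.1; have lt2 := ltn_ord p.2.
  have /val_inj E1 : val (tau (tau p)).1 = val p.1.
    by rewrite [LHS]/= /bump tau2 /= /bump /unbump; lia.
  have /val_inj E2 : val (tau (tau p)).2 = val p.2.
    by rewrite tau2 [(tau p).1]/= tau2 /= /bump /unbump;
      lia.
  by rewrite [LHS]surjective_pairing E1 E2 -surjective_pairing.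
pose P (p : 'I_n.+3 * 'I_n.+2) := (p.2 < p.1)%N.
rewrite (bigID P) /= [X in _ + X](reindex_inj (inv_inj tauK)).
rewrite [X in _ + X](eq_bigl P) => [|p]; last first.
  by rewrite /P tau2 /= /bump /unbump; lia.
rewrite -big_split big1 //= => p lt_p; rewrite HG tau2 /=.
have -> : (bump p.1 p.2 + unbump p.2 p.1 = (p.1 + p.2).-1)%N.
  by move: lt_p; rewrite /P /bump /unbump; lia.
case: (p.1 + p.2)%N (leq_ltn_trans (leq0n _) (ltn_addr p.2 lt_p)) => // m _.
by rewrite exprS mulN1r scaleNr addNr.
Qed.

Lemma boundary_boundary n X (c : chain n.+1 X) :
  boundary n X (boundary n.+1 X c) = 0.
Proof.
case: n c => [//|n] c; rewrite {2}/boundary {1}/linext linear_sum big1 // => s _.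
rewrite linearZ linear_sum /=.
pose G i j : chain n X := fgen (dcomp s (dcomp (face i) (face j))).
rewrite -[RHS](scaler0 _ (c s : R)); congr (_ *: _).
rewrite -[RHS](@alternating_sum0 n _ G) => [|i j]; last first.
  by rewrite /G -face_face.
apply: eq_bigr => i _; rewrite linearZ /= linext_gen scaler_sumr.
by apply: eq_bigr => j _; rewrite scalerA exprD /G dcompA.
Qed.

Lemma coboundary_coboundary n X (p : dualmod (chain n.-1 X)) :
  dualmap (boundary n.+1 X) (dualmap (boundary n X) p) = 0.
Proof. by apply: linear_ext => c /=; rewrite boundary_boundary linear0. Qed.

Definition dH (n : nat) (X : digimage) : lmodType R :=
  homology (boundary n.+1 X) (boundary n X).

Definition dcoH (n : nat) (X : digimage) : lmodType R :=
  homology (dualmap (boundary n X)) (dualmap (boundary n.+1 X)).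

End Chains.

Arguments pushforward {R} n {X Y} f.

(* Main.v *)
Require Import Defs.
From HB Require Import structures.
From mathcomp Require Import all_boot all_algebra boolp.

Set Implicit Arguments.
Unset Strict Implicit.
Unset Printing Implicit Defensive.

Import GRing.Theory.
Local Open Scope ring_scope.

(** A linear map preserving cycles and boundaries induces a unique linear map
    on homology. Hence the induced maps can be chosen arbitrarily, and functor
    laws for the chain maps pass to homology by uniqueness. That the pushforward
    is a chain map is the associativity of composition,
    [f \o (s \o face i) = (f \o s) \o face i]; cohomology follows by dualising
    the commuting squares. *)

Section InducedMap.
Variables (R : pzRingType) (U V W U' V' W' : lmodType R).
Variables (f : {linear U -> V}) (g : {linear V -> W}).
Variables (f' : {linear U' -> V'}) (g' : {linear V' -> W'}).

(** [induces] only provides some cycle over [phi (val z)]; a cycle is determined by its underlying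
    vector, so any such cycle may be used. *)
Lemma induces_hclass (phi : V -> V') h z z' :
  induces f g f' g' phi h -> phi (val z) = val z' ->
  h (hclass f z) = hclass f' z'.
Proof. by move=> /(_ z)[y Ey ->] Ez; congr hclass; apply/val_inj; rewrite -Ey. Qed.

(** Every class has a representing cycle, on which both maps are forced. Two pointwise equal maps
    are allowed so that identities between chain maps can be fed in directly. *)
Lemma induces_unique (phi phi' : V -> V') h k : phi =1 phi' ->
  induces f g f' g' phi h -> induces f g f' g' phi' k -> h =1 k.
Proof.
move=> Ephi hP kP c; rewrite -(hclass_repr c).
have [z' Ez ->] := hP (repr c).
by rewrite (induces_hclass kP (z' := z')) // -Ephi.
Qed.

(** The square with [beta] sends cycles to cycles, as [beta] maps 0 to 0; the square with [alpha]
    carries a preimage under [f] to one under [f'], so boundaries go to boundaries. *)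
Lemma induced_map_exists (phi : {linear V -> V'}) (alpha : U -> U')
    (beta : {linear W -> W'}) :
    (forall u, f' (alpha u) = phi (f u)) ->
    (forall v, g' (phi v) = beta (g v)) ->
  exists h : {linear homology f g -> homology f' g'},
    induces f g f' g' phi h.
Proof.
move=> Ef Eg.
have cyc (z : cycles g) : phi (val z) \in kernel g'.
  have := valP z; rewrite !unfold_in => /eqP gz.
  by rewrite Eg gz linear0.
pose m z : cycles g' := Cycle (cyc z).
have m_lin a y z : m (a *: y + z) = a *: m y + m z.
  by apply: val_inj; rewrite /= !linearP.
have mB y z : m (y - z) = m y - m z.
  by apply: val_inj; rewrite /= !linearB.
pose h (c : homology f g) : homology f' g' := hclass f' (m (repr c)).
(* Independence of the chosen representative: it differs from [z] by some [f u], whose image is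
   [f' (alpha u)]. *)
have hE z : h (hclass f z) = hclass f' (m z).
  apply/hclassP; rewrite -mB unfold_in.
  have /hclassP : hclass f (repr (hclass f z)) = hclass f z.
    exact: hclass_repr.
  rewrite unfold_in => /asboolP[u Eu]; apply/asboolP; exists (alpha u).
  by rewrite Ef Eu.
have h_lin : linear h.
  move=> a c d; rewrite -(hclass_repr c) -(hclass_repr d).
  by rewrite -hclassZ -hclassD !hE m_lin hclassD hclassZ.
pose hL := GRing.isLinear.Build R (homology f g) (homology f' g') *:%R h h_lin.
pose H : {linear homology f g -> homology f' g'} := HB.pack h hL.
by exists H => z; exists (m z) => //; apply: hE.
Qed.

End InducedMap.

Lemma induces_id (R : pzRingType) (U V W : lmodType R)
    (f : {linear U -> V}) (g : {linear V -> W}) :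
  induces f g f g id id.
Proof. by move=> z; exists z. Qed.

Lemma induces_comp (R : pzRingType) (U V W U' V' W' U'' V'' W'' : lmodType R)
    (f : {linear U -> V}) (g : {linear V -> W})
    (f' : {linear U' -> V'}) (g' : {linear V' -> W'})
    (f'' : {linear U'' -> V''}) (g'' : {linear V'' -> W''}) phi psi h k :
  induces f g f' g' phi h -> induces f' g' f'' g'' psi k ->
  induces f g f'' g'' (psi \o phi) (k \o h).
Proof.
move=> hP kP z; have [y Ey hy] := hP z; have [x Ex kx] := kP y.
by exists x; rewrite /= ?Ey ?hy.
Qed.

Lemma freemod_linear_ext (R : pzRingType) (S : finType) (V : lmodType R)
    (f g : {linear freemod R S -> V}) :
  (forall s, f (fgen s) = g (fgen s)) -> f =1 g.
Proof.
move=> fg c; have -> : c = \sum_s (c s : R) *: (fgen s : freemod R S).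
  apply/ffunP => t; rewrite sum_ffunE (bigD1 t) //= big1 => [|s st].
    (* Scaling in [R^o] is multiplication in [R], so the surviving term is [c t * 1] by
       conversion. *)
    by rewrite !ffunE eqxx addr0 [LHS](esym (mulr1 _)).
  by rewrite !ffunE eq_sym (negPf st); apply: mulr0.
by rewrite !linear_sum; apply: eq_bigr => s _; rewrite !linearZ /= fg.
Qed.

Section Pushforward.
Variables (R : comPzRingType) (n : nat).

Lemma pushforward_gen X Y (f : dmap X Y) (s : simplex n X) :
  pushforward n f (fgen s : chain R n X) = fgen (dcomp f s).
Proof. exact: linext_gen. Qed.

Lemma boundary_gen X (s : simplex n.+1 X) :
  boundary R n.+1 X (fgen s) =
  \sum_(i < n.+2) (-1) ^+ i *: (fgen (dcomp s (face i)) : chain R n X).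
Proof. exact: linext_gen. Qed.

Lemma pushforward_id X : @pushforward R n _ _ (did X) =1 id.
Proof.
apply: (@freemod_linear_ext _ _ _ (pushforward n (did X)) idfun) => s.
by rewrite pushforward_gen dcomp1f.
Qed.

Lemma pushforward_comp X Y Z (g : dmap Y Z) (f : dmap X Y) :
  @pushforward R n _ _ (dcomp g f) =1 pushforward n g \o pushforward n f.
Proof.
apply: (@freemod_linear_ext _ _ _ _ (pushforward n g \o pushforward n f)) => s.
by rewrite [RHS]/= !pushforward_gen dcompA.
Qed.

End Pushforward.

Lemma boundary_pushforward (R : comPzRingType) n X Y (f : dmap X Y)
    (c : chain R n X) :
  boundary R n Y (pushforward n f c) = pushforward n.-1 f (boundary R n X c).
Proof.
(* In degree 0 both boundaries are the zero map. *)
case: n c => [|n] c; first by rewrite /= linear0.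
apply: (@freemod_linear_ext _ _ _ (boundary R n.+1 Y \o pushforward n.+1 f)
  (pushforward n f \o boundary R n.+1 X)) => s.
change (boundary R n.+1 Y (pushforward n.+1 f (fgen s)) =
  pushforward n f (boundary R n.+1 X (fgen s))).
rewrite pushforward_gen !boundary_gen linear_sum.
by apply: eq_bigr => i _; rewrite linearZ pushforward_gen dcompA.
Qed.

Section Functors.
Variables (R : comPzRingType) (n : nat).

Lemma dH_map_exists X Y (f : dmap X Y) :
  exists h : {linear dH R n X -> dH R n Y},
    induces (boundary R n.+1 X) (boundary R n X)
            (boundary R n.+1 Y) (boundary R n Y) (pushforward n f) h.
Proof.
apply: (induced_map_exists (alpha := pushforward n.+1 f)
  (beta := pushforward n.-1 f)) => c; last exact: boundary_pushforward.
(* The degree is given explicitly because [n.+1.-1] appears here already reduced to [n]. *)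
exact: (@boundary_pushforward R n.+1).
Qed.

Lemma dcoH_map_exists X Y (f : dmap X Y) :
  exists h : {linear dcoH R n Y -> dcoH R n X},
    induces (dualmap (boundary R n Y)) (dualmap (boundary R n.+1 Y))
            (dualmap (boundary R n X)) (dualmap (boundary R n.+1 X))
            (dualmap (pushforward n f)) h.
Proof.
(* Dualising exchanges the neighbouring degrees: coboundaries come from degree [n.-1], and the
   cocycle condition lives in degree [n.+1]. *)
apply: (induced_map_exists (alpha := dualmap (pushforward n.-1 f))
  (beta := dualmap (pushforward n.+1 f))) => p; apply: linear_ext => c /=.
  by rewrite boundary_pushforward.
by rewrite (@boundary_pushforward R n.+1).
Qed.

End Functors.

Theorem proposition3p10 (R : comPzRingType) (n : nat) :
  (exists F : functor_on (C := digCat) (D := modCat R) (dH R n),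
     forall (X Y : digimage) (f : dmap X Y),
       induces (boundary R n.+1 X) (boundary R n X)
               (boundary R n.+1 Y) (boundary R n Y)
               (pushforward n f) (fmap F f))
  /\
  (exists F : cofunctor_on (C := digCat) (D := modCat R) (dcoH R n),
     forall (X Y : digimage) (f : dmap X Y),
       induces (dualmap (boundary R n Y)) (dualmap (boundary R n.+1 Y))
               (dualmap (boundary R n X)) (dualmap (boundary R n.+1 X))
               (dualmap (pushforward n f)) (fmap F f)).
Proof.
split.
- pose H X Y (f : dmap X Y) := sval (cid (dH_map_exists R n f)).
  have HP X Y (f : dmap X Y) := svalP (cid (dH_map_exists R n f)).
  have H_id X : H X X (did X) = lin_id (dH R n X).
    apply: linear_ext.
    exact: (induces_unique (@pushforward_id R n X) (HP X X _)
      (@induces_id _ _ _ _ _ _)).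
  have H_comp X Y Z (g : dmap Y Z) (f : dmap X Y) :
      H X Z (dcomp g f) = lin_comp (H Y Z g) (H X Y f).
    apply: linear_ext; apply: (induces_unique _ (HP _ _ _)
      (induces_comp (HP _ _ f) (HP _ _ g))).
    exact: pushforward_comp.
  by exists (@FunctorOn digCat (modCat R) (dH R n) H H_id H_comp).
(* The objects are listed as [Y X] because [f] is a morphism from [Y] to [X] in the opposite
   category. *)
pose H Y X (f : dmap X Y) := sval (cid (dcoH_map_exists R n f)).
have HP X Y (f : dmap X Y) := svalP (cid (dcoH_map_exists R n f)).
have H_id X : H X X (did X) = lin_id (dcoH R n X).
  have dual_id : dualmap (@pushforward R n _ _ (did X)) =1 id.
    by move=> p; apply: linear_ext => c /=; rewrite pushforward_id.
  apply: linear_ext.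
  exact: (induces_unique dual_id (HP X X _) (@induces_id _ _ _ _ _ _)).
have H_comp Z Y X (g : dmap Y Z) (f : dmap X Y) :
    H Z X (dcomp g f) = lin_comp (H Y X f) (H Z Y g).
  (* The dual of a composite applies the dual of [g] first, then that of [f]. *)
  apply: linear_ext; apply: (induces_unique _ (HP _ _ _)
    (induces_comp (HP _ _ g) (HP _ _ f))) => p.
  by apply: linear_ext => c /=; rewrite pushforward_comp.
(* Composition in [opposite digCat] takes its arguments in the reverse order, hence the swap of [f]
   and [g]. *)
by exists (@FunctorOn (opposite digCat) (modCat R) (dcoH R n) H H_id
  (fun Z Y X f g => H_comp Z Y X g f)).
Qed.
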